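(* Let $1 \le t \le k < n$ be integers, and let $x_1, \dots, x_n$ be real numbers of which exactly $t$ are nonnegative. Suppose that for every subset $U \subseteq \{1,\dots,n\}$ with $|U| > k$ we have $\sum_{i\in U} x_i < 0$. Then the number of subsets $U \subseteq \{1,\dots,n\}$ (including the empty set) with $\sum_{i \in U} x_i \ge 0$ is at most $$2^{t-1}\left(\binom{n-t}{k-t} + \binom{n-t}{k-t-1} + \cdots + \binom{n-t}{0} + 1\right).$$ Moreover, this bound is tight: for all integers $1 \le t \le k < n$ there exist real numbers $x_1,\dots,x_n$, exactly $t$ of them nonnegative, satisfying the hypothesis and having exactly this many subsets with nonnegative sum.
   Context: Subsets of the sequence are identified with subsets of the index set $\{1,\dots,n\}$; the empty set has sum $0$ and so counts as a subset with nonnegative sum. *)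

(* Defs.v *)
From mathcomp Require Import all_boot all_order all_algebra.
From mathcomp Require Import reals.

Set Implicit Arguments.
Unset Strict Implicit.
Unset Printing Implicit Defensive.

Import Order.TTheory GRing.Theory Num.Theory.

Local Open Scope ring_scope.

(* Subsets of the index set, so equal values at distinct indices count
   separately; the empty set is a member since its sum is 0. *)
Definition nonneg_subsets (R : realType) (n : nat) (x : 'I_n -> R) :
    {set {set 'I_n}} :=
  [set U : {set 'I_n} | 0 <= \sum_(i in U) x i].

Definition exactly_nonneg (R : realType) (n t : nat) (x : 'I_n -> R) : Prop :=
  #|[set i : 'I_n | 0 <= x i]| = t.

Definition large_sums_neg (R : realType) (n k : nat) (x : 'I_n -> R) : Prop :=
  forall U : {set 'I_n}, (k < #|U|)%N -> \sum_(i in U) x i < 0.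

(* The subtractions are never truncated when 1 <= t <= k < n. *)
Definition subset_bound (n k t : nat) : nat :=
  (2 ^ (t - 1) * ((\sum_(0 <= j < (k - t).+1) 'C(n - t, j)) + 1))%N.

(* Main.v *)
(* Let P be the set of nonnegative indices and split U = A + B with A inside P and
   B outside. Pair A with P \ A: let X (resp. Y) be the family of those B for which
   A + B (resp. (P \ A) + B) has nonnegative sum. If B is in X and C is in Y then
   P + (B u C) has nonnegative sum, so |B u C| <= m := k - t. It is enough to show
   |X| + |Y| <= 1 + sum_(j <= m) 'C(n - t, j).
   Averaging over all permutations of a fixed pair of sets of sizes i and j with
   union larger than m shows that the densities x_i of X in layer i and y_j of Y in
   layer j satisfy x_i + y_j <= 1 whenever i + j > m. Applying this to (i, j),
   (j, i) and (j, j) for i <= j, i + j = m + 1, and using 'C(n - t, i) <= 'C(n - t, j),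
   bounds the total contribution of layers i and j by 'C(n - t, i) + 'C(n - t, j)
   for 1 <= i <= m, while layer 0 contributes at most 2.
   Equality holds for x = (k - t, 0, ..., 0, -1, ..., -1). *)
Require Import Defs.
From mathcomp Require Import all_boot all_order all_algebra all_fingroup.
From mathcomp Require Import reals zify lra.

Set Implicit Arguments.
Unset Strict Implicit.
Unset Printing Implicit Defensive.

Import Order.TTheory GRing.Theory Num.Theory.

Local Open Scope ring_scope.

(** * Random images of a set under permutations *)

Lemma exists_perm_imset (T : finType) (A B : {set T}) :
  #|A| = #|B| -> exists s : {perm T}, s @: A = B.
Proof.
move=> eqAB.
(* Each set is listed before its complement; matching positions of [sq A] and [sq B] carries [A]
   onto [B], since the two initial segments have equal length. *)
pose sq (C : {set T}) := enum C ++ enum (~: C).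
have size_sq C : size (sq C) = #|T| by rewrite size_cat -!cardE cardsC.
have mem_sq C x : x \in sq C by rewrite mem_cat !mem_enum inE orbN.
have uniq_sq C : uniq (sq C).
  rewrite cat_uniq !enum_uniq andbT /=.
  by apply/hasPn=> x; rewrite !mem_enum inE.
have idx_lt x : (index x (sq A) < size (sq B))%N.
  by rewrite size_sq -(size_sq A) index_mem.
pose f x := nth x (sq B) (index x (sq A)).
have f_inj : injective f.
  move=> x y; rewrite /f (set_nth_default y) // => /eqP.
  rewrite nth_uniq // => /eqP eq_idx.
  by rewrite -(nth_index x (mem_sq A x)) eq_idx nth_index.
exists (perm f_inj); apply/eqP; rewrite eqEcard card_imset; last exact: perm_inj.
rewrite eqAB leqnn andbT; apply/subsetP=> _ /imsetP[x Ax ->].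
rewrite permE /f nth_cat -cardE -eqAB.
have lt_idx : (index x (sq A) < #|A|)%N.
  by rewrite index_cat mem_enum Ax cardE index_mem mem_enum.
by rewrite lt_idx -mem_enum mem_nth // -cardE -eqAB.
Qed.

Lemma card_perm_type (T : finType) : #|{perm T}| = #|T|`!.
Proof.
rewrite -[in RHS]cardsT -card_perm; apply: eq_card => s.
by rewrite !inE; apply/esym/subsetP=> x; rewrite inE.
Qed.

(** Averaging principle, cleared of denominators: the probability that a random image of [A] lies in
    [X] is the density of [X] among sets of size [#|A|]. *)
Lemma card_perm_imset (T : finType) (A : {set T}) (X : {set {set T}}) :
  (#|[set s : {perm T} | s @: A \in X]| * 'C(#|T|, #|A|) =
   #|[set B in X | #|B| == #|A|]| * #|T|`!)%N.
Proof.
pose c (B : {set T}) := #|[set s : {perm T} | s @: A == B]|.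
have cE (B : {set T}) : #|B| = #|A| -> c B = c A.
  move=> /esym /exists_perm_imset[p pA].
  have actM (r q : {perm T}) : (r * q)%g @: A = q @: (r @: A).
    by rewrite -imset_comp; apply: eq_imset => x /=; rewrite permM.
  (* Right multiplication by [p] maps the stabilizer of [A] onto the permutations sending [A] to
     [B]. *)
  rewrite /c -(card_imset [set s : {perm T} | s @: A == A] (mulIg p)).
  congr #|pred_of_set _|; apply/setP=> s; rewrite [LHS]inE.
  apply/eqP/imsetP => [sA | [r]].
    exists (s * p^-1)%g; last by rewrite mulgKV.
    rewrite inE actM sA -pA -imset_comp; apply/eqP; rewrite -[RHS]imset_id.
    by apply: eq_imset => x /=; rewrite permK.
  by rewrite inE => /eqP rA ->; rewrite actM rA.
have countE (Y : {set {set T}}) :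
    #|[set s : {perm T} | s @: A \in Y]| = (#|[set B in Y | #|B| == #|A|]| * c A)%N.
  rewrite -sum1_card (partition_big (fun s : {perm T} => s @: A)
    (mem [set B in Y | #|B| == #|A|])) /=; last first.
    by move=> s; rewrite !inE => ->; rewrite card_imset ?eqxx //; exact: perm_inj.
  rewrite -sum_nat_const; apply: eq_bigr => B; rewrite inE => /andP[YB /eqP cB].
  rewrite -(cE B cB) /c -sum1_card; apply: eq_bigl => s; rewrite !inE.
  by case: eqP => [->|_]; rewrite ?YB ?andbF.
(* Counting for the family of all sets evaluates [c A] without computing the stabilizer. *)
have := countE setT.
have -> : [set s : {perm T} | s @: A \in [set: {set T}]] = setT.
  by apply/setP=> s; rewrite !inE.
have -> : [set B in [set: {set T}] | #|B| == #|A|] = [set B : {set T} | #|B| == #|A|].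
  by apply/setP=> s; rewrite !inE.
rewrite card_draws cardsT => factE.
by rewrite -card_perm_type factE countE -mulnA [(c A * _)%N]mulnC.
Qed.

(** * Pairs of families with small cross unions *)

Lemma exists_subset_card (T : finType) (A : {set T}) (m : nat) :
  (m <= #|A|)%N -> exists2 B : {set T}, B \subset A & #|B| = m.
Proof.
rewrite -bin_gt0 -(cards_draws A m) => /card_gt0P[B].
by rewrite inE => /andP[sBA /eqP cB]; exists B.
Qed.

(** Disjoint sets work if they fit; otherwise the two sets can be chosen to cover [T]. *)
Lemma exists_large_union (T : finType) (m i j : nat) :
  (i <= #|T|)%N -> (j <= #|T|)%N -> (m < i + j)%N -> (m < #|T|)%N ->
  exists A B : {set T}, [/\ #|A| = i, #|B| = j & (m < #|A :|: B|)%N].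
Proof.
move=> iT jT mij mT.
have [A _ cA] : exists2 A : {set T}, A \subset setT & #|A| = i.
  by apply: exists_subset_card; rewrite cardsT.
have cAC : #|~: A| = (#|T| - i)%N by have := cardsC A; lia.
have [le_ji | lt_ij] := leqP j (#|T| - i).
  have [B sBA cB] : exists2 B : {set T}, B \subset ~: A & #|B| = j.
    by apply: exists_subset_card; lia.
  exists A, B; split=> //; rewrite cardsU (disjoint_setI0 _) ?cards0; first lia.
  by rewrite disjoint_sym disjoints_subset.
have [B sBA cB] : exists2 B : {set T}, B \subset A & #|B| = (#|T| - j)%N.
  by apply: exists_subset_card; lia.
exists A, (~: B); split=> //; first by have := cardsC B; lia.
suff -> : A :|: ~: B = setT by rewrite cardsT.
apply/setP=> x; rewrite !inE; have /subsetP/(_ x) := sBA.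
by case: (x \in B); case: (x \in A) => // ->.
Qed.

Definition layer (T : finType) (X : {set {set T}}) (i : nat) : {set {set T}} :=
  [set B in X | #|B| == i].

(** The density inequality with denominators cleared. A permutation preserves the size of [A :|: B],
    so it cannot send [A] into [X] and [B] into [Y] at once. *)
Lemma layer_cross_union (T : finType) (X Y : {set {set T}}) (m i j : nat) :
  (forall B C, B \in X -> C \in Y -> (#|B :|: C| <= m)%N) ->
  (i <= #|T|)%N -> (j <= #|T|)%N -> (m < i + j)%N -> (m < #|T|)%N ->
  (#|layer X i| * 'C(#|T|, j) + #|layer Y j| * 'C(#|T|, i)
     <= 'C(#|T|, i) * 'C(#|T|, j))%N.
Proof.
move=> XYm iT jT mij mT.
have [A [B [cA cB AB]]] := @exists_large_union T m i j iT jT mij mT.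
have := card_perm_imset A X; have := card_perm_imset B Y.
rewrite cA cB -!/(layer _ _).
set SX := [set s : {perm T} | s @: A \in X]; set SY := [set s : {perm T} | s @: B \in Y].
move=> SYE SXE.
have disj : [disjoint SX & SY].
  rewrite -setI_eq0 -subset0; apply/subsetP=> s; rewrite !inE => /andP[XA YB].
  have := XYm _ _ XA YB; rewrite -imsetU card_imset; last exact: perm_inj.
  by rewrite leqNgt AB.
have : (#|SX| + #|SY| <= #|T|`!)%N.
  rewrite -card_perm_type -cardsUI
    (disjoint_setI0 disj) cards0 addn0; exact: max_card.
move=> leS; rewrite -(leq_pmul2r (fact_gt0 #|T|)) mulnDl.
rewrite mulnAC -SXE (mulnAC #|layer Y j|) -SYE -!mulnA [('C(_, j) * _)%N]mulnC.
by rewrite -mulnDl [leqRHS]mulnA [leqRHS]mulnC leq_mul2r leS orbT.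
Qed.

Lemma leq_bin_symm (n i j : nat) :
  (i <= j)%N -> (i + j <= n)%N -> ('C(n, i) <= 'C(n, j))%N.
Proof.
move=> ij ijn.
have jn : (j <= n)%N by lia.
have iN : (i <= n)%N by lia.
have Ei := bin_fact iN; have Ej := bin_fact jn.
have le_fact : (j`! * (n - j)`! <= i`! * (n - i)`!)%N.
  (* Up to the common factor [(j - i)!], these binomials are the ratios [j! / i!] and
     [(n - i)! / (n - j)!]. *)
  have leB : ('C(j, j - i) <= 'C(n - i, j - i))%N by apply: leq_bin2l; lia.
  have le_jj : (j - i <= j)%N by lia.
  have le_jn : (j - i <= n - i)%N by lia.
  rewrite -(bin_fact le_jj) -(bin_fact le_jn).
  rewrite subKn // subnBA // subnK //.
  have := leq_mul leB (leqnn ((j - i)`! * i`! * (n - j)`!)); lia.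
have p : (0 < j`! * (n - j)`!)%N by rewrite muln_gt0 !fact_gt0.
by rewrite -(leq_pmul2r p) Ej -Ei leq_mul2l le_fact orbT.
Qed.

Lemma card_layers (T : finType) (X : {set {set T}}) (m : nat) :
  (forall B, B \in X -> (#|B| <= m)%N) ->
  #|X| = (\sum_(0 <= i < m.+1) #|layer X i|)%N.
Proof.
move=> Xm; rewrite big_mkord -sum1_card.
rewrite (partition_big (fun B : {set T} => inord #|B| : 'I_m.+1) predT) //=.
apply: eq_bigr => i _; rewrite -sum1_card; apply: eq_bigl => B; rewrite inE.
have [XB|//] := boolP (B \in X).
by rewrite -val_eqE /= inordK // ltnS Xm.
Qed.

Lemma cross_union_pair (T : finType) (X Y : {set {set T}}) (m i j : nat) :
  (forall B C, B \in X -> C \in Y -> (#|B :|: C| <= m)%N) ->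
  (m < #|T|)%N -> (i <= j)%N -> (i + j = m.+1)%N ->
  (#|layer X i| + #|layer Y i| + (#|layer X j| + #|layer Y j|)
     <= 'C(#|T|, i) + 'C(#|T|, j))%N.
Proof.
move=> XYm mT ij ijm.
have YXm B C : B \in Y -> C \in X -> (#|B :|: C| <= m)%N.
  by move=> YB XC; rewrite setUC XYm.
have jT : (j <= #|T|)%N by lia.
have iT : (i <= #|T|)%N by lia.
have mij : (m < i + j)%N by lia.
have mjj : (m < j + j)%N by lia.
have h1 := layer_cross_union XYm iT jT mij mT.
have h2 := layer_cross_union YXm iT jT mij mT.
have h3 := layer_cross_union XYm jT jT mjj mT.
have cij : ('C(#|T|, i) <= 'C(#|T|, j))%N by apply: leq_bin_symm; lia.
have cj : (0 < 'C(#|T|, j))%N by rewrite bin_gt0.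
rewrite -mulnDl leq_pmul2r // in h3.
move: h1 h2 h3 cij cj; set a := #|layer X i|; set b := #|layer X j|.
set c := #|layer Y i|; set d := #|layer Y j|; move: 'C(_, i) 'C(_, j) => ci cj.
move=> h1 h2 h3 cij cj0; rewrite -(leq_pmul2r cj0).
(* Adding this to [h1] and [h2] raises the coefficient of [b + d] from [ci] to [cj], so that [cj]
   can be cancelled. *)
have : ((b + d) * (cj - ci) <= cj * (cj - ci))%N by rewrite leq_mul2r h3 orbT.
rewrite !mulnBr; nia.
Qed.

Lemma cross_union_bound (T : finType) (X Y : {set {set T}}) (m : nat) :
  (forall B C, B \in X -> C \in Y -> (#|B :|: C| <= m)%N) ->
  X != set0 -> Y != set0 -> (m < #|T|)%N ->
  (#|X| + #|Y| <= (\sum_(0 <= j < m.+1) 'C(#|T|, j)) + 1)%N.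
Proof.
move=> XYm /set0Pn[B0 XB0] /set0Pn[C0 YC0] mT.
(* A member of either family lies in its union with a fixed member of the other, hence has size at
   most [m]. *)
rewrite (@card_layers _ X m); last first.
  by move=> B XB; apply: leq_trans (XYm _ _ XB YC0); rewrite subset_leq_card ?subsetUl.
rewrite (@card_layers _ Y m); last first.
  by move=> C YC; apply: leq_trans (XYm _ _ XB0 YC); rewrite subset_leq_card ?subsetUr.
rewrite !(big_nat_recl m) // bin0.
(* Both families may contain the empty set, while ['C(#|T|, 0)] pays for only one: this is the extra
   [1]. *)
have layer0 (Z : {set {set T}}) : (#|layer Z 0| <= 1)%N.
  rewrite -(cards1 (@set0 T)); apply/subset_leq_card/subsetP=> B.
  by rewrite !inE cards_eq0 => /andP[].
suff : (\sum_(0 <= i < m) (#|layer X i.+1| + #|layer Y i.+1|)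
         <= \sum_(0 <= i < m) 'C(#|T|, i.+1))%N.
  rewrite big_split /= => leXY; rewrite addnACA [leqRHS]addnAC.
  by apply: leq_add leXY; apply: (leq_add (layer0 X) (layer0 Y)).
have double_sum (F : nat -> nat) : ((\sum_(0 <= i < m) F i).*2 =
    \sum_(i < m) (F i + F (m - i.+1)))%N.
  by rewrite -addnn {2}big_nat_rev -big_split big_mkord.
(* Each layer i is counted twice, once together with its partner m + 1 - i. *)
rewrite -leq_double double_sum (double_sum (fun i => 'C(#|T|, i.+1))).
apply: leq_sum => i _; have im := ltn_ord i.
have [ij|/ltnW ij] := leqP i.+1 (m - i.+1).+1.
  by apply: (cross_union_pair XYm) => //; lia.
by rewrite addnC (addnC 'C(_, _)); apply: (cross_union_pair XYm) => //; lia.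
Qed.

(** * Slicing a family by the trace on [P] *)

(** Using the subtype of indices outside [P] as ground set lets the cross-union bound apply with
    [#|T| - #|P|] points. *)
Definition slice (T : finType) (F : {set {set T}}) (P A : {set T}) :
    {set {set {i : T | i \notin P}}} :=
  [set B : {set {i : T | i \notin P}} | A :|: val @: B \in F].

Lemma union_valE (T : finType) (P A : {set T}) (B : {set {i : T | i \notin P}}) :
  A \subset P -> (A :|: val @: B) :\: P = val @: B /\ (A :|: val @: B) :&: P = A.
Proof.
move=> sAP; have BP : [disjoint val @: B & P].
  rewrite disjoint_subset; apply/subsetP=> _ /imsetP[j _ ->]; exact: valP j.
split.
  by rewrite setDUl (setDidPl BP); move: sAP; rewrite -setD_eq0 => /eqP ->; rewrite set0U.
by rewrite setIUl (disjoint_setI0 BP) setU0; apply/setIidPl.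
Qed.

Lemma card_slices (T : finType) (F : {set {set T}}) (P : {set T}) :
  #|F| = (\sum_(A in powerset P) #|slice F P A|)%N.
Proof.
rewrite -sum1_card (partition_big (fun U => U :&: P) (mem (powerset P))) /=; last first.
  by move=> U _; rewrite inE subsetIr.
apply: eq_bigr => A; rewrite inE => sAP.
have inj : injective (fun B : {set {i : T | i \notin P}} => A :|: val @: B).
  move=> B C eqBC; apply: (imset_inj val_inj).
  by rewrite -(union_valE B sAP).1 eqBC (union_valE C sAP).1.
rewrite sum1dep_card -(card_imset _ inj); congr #|pred_of_set _|; apply/setP=> U.
rewrite inE; apply/andP/imsetP => [[FU /eqP UA] | [B]]; last first.
  by rewrite inE => FU ->; split=> //; rewrite (union_valE B sAP).2.
have UE : U = A :|: val @: [set i : {i : T | i \notin P} | val i \in U].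
  apply/setP=> i; rewrite -UA !inE; have [iP | iP] := boolP (i \in P).
    rewrite andbT; apply/idP/orP => [|[//|/imsetP[j]]]; first by left.
    by rewrite inE => jU ->.
  rewrite andbF /=; apply/idP/imsetP => [iU | [j]]; last by rewrite inE => jU ->.
  by exists (Sub i iP); rewrite ?inE SubK.
by exists [set i : {i : T | i \notin P} | val i \in U]; rewrite // inE -UE.
Qed.

(** Complementation in [P] is an involution of [powerset P]; doubling avoids choosing a
    representative of each pair. *)
Lemma double_card_slices (T : finType) (F : {set {set T}}) (P : {set T}) :
  (#|F|.*2 = \sum_(A in powerset P) (#|slice F P A| + #|slice F P (P :\: A)|))%N.
Proof.
rewrite big_split /= -addnn {1 2}(card_slices F P); congr addn.
rewrite (reindex_onto (fun A => P :\: A) (fun A => P :\: A)) /=; last first.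
  by move=> A; rewrite inE => sAP; rewrite setDDr setDv set0U; apply/setIidPr.
apply: eq_bigl => A; rewrite !inE subsetDl /= setDDr setDv set0U.
by apply/eqP/setIidPr.
Qed.

Lemma card_notin (T : finType) (P : {set T}) :
  #|{: {i : T | i \notin P}}| = (#|T| - #|P|)%N.
Proof.
rewrite card_sig -(cardsC P) addKn.
by apply: eq_card => i; rewrite !inE.
Qed.

Lemma sum_union_val (V : zmodType) (T : finType) (x : T -> V) (P A : {set T})
    (B : {set {i : T | i \notin P}}) : A \subset P ->
  \sum_(i in A :|: val @: B) x i = \sum_(i in A) x i + \sum_(i in B) x (val i).
Proof.
move=> sAP; rewrite (big_setID P) /= (union_valE B sAP).1 (union_valE B sAP).2.
by congr (_ + _); rewrite big_imset //= => i j _ _; exact: val_inj.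
Qed.

(** The sums over [A + B] and [(P :\: A) + C] add up to the sum over [P + (B :|: C)] plus that over
    [C :&: B]. The last is at most 0, so the sum over [P + (B :|: C)] is nonnegative and this set
    has at most [k] elements. *)
Lemma nonneg_slice_union (R : realType) (n k t : nat) (x : 'I_n -> R)
    (P := [set i | 0 <= x i]) (A : {set 'I_n}) :
  exactly_nonneg t x -> large_sums_neg k x -> (t <= k)%N -> A \subset P ->
  forall B C, B \in slice (nonneg_subsets x) P A ->
    C \in slice (nonneg_subsets x) P (P :\: A) -> (#|B :|: C| <= k - t)%N.
Proof.
move=> xt xk tk sAP B C; rewrite !inE !(sum_union_val, subsetDl) // => hB hC.
rewrite leqNgt; apply/negP=> ltBC.
have := xk (P :|: val @: (B :|: C)); rewrite sum_union_val //.
have -> : (k < #|P :|: val @: (B :|: C)|)%N.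
  rewrite -(cardsID P) (union_valE (B :|: C) (subxx P)).1 (union_valE _ (subxx P)).2.
  rewrite card_imset; last exact: val_inj.
  by move: xt ltBC; rewrite /exactly_nonneg -/P => ->; move: #|B :|: C|; lia.
move=> /(_ isT); rewrite (big_setID A) /= (setIidPr sAP) ltNge => /negP; apply.
rewrite (big_setID B) /= setUK setDUl setDv set0U.
rewrite (big_setID B) /= in hC.
suff : \sum_(i in C :&: B) x (val i) <= 0 by lra.
apply: sumr_le0 => i _; have := valP i; rewrite inE -ltNge; exact: ltW.
Qed.

Lemma nonneg_subsets_le (R : realType) (n k t : nat) (x : 'I_n -> R) :
  (0 < t)%N -> (t <= k)%N -> (k < n)%N -> exactly_nonneg t x -> large_sums_neg k x ->
  (#|nonneg_subsets x| <= subset_bound n k t)%N.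
Proof.
move=> t0 tk kn xt xk; set P := [set i | 0 <= x i].
have cP : #|P| = t by [].
(* Supplies the nonemptiness that the cross-union bound requires. *)
have set0_slice (A : {set 'I_n}) : A \subset P -> slice (nonneg_subsets x) P A != set0.
  move=> /subsetP sAP; apply/set0Pn; exists set0; rewrite !inE imset0 setU0.
  by apply: sumr_ge0 => i /sAP; rewrite inE.
rewrite -leq_double (double_card_slices _ P).
apply: leq_trans (_ : (\sum_(A in powerset P)
    ((\sum_(0 <= j < (k - t).+1) 'C(n - t, j)) + 1) <= _)%N).
  apply: leq_sum => A; rewrite inE => sAP.
  have := cross_union_bound (nonneg_slice_union xt xk tk sAP) (set0_slice _ sAP)
    (set0_slice _ (subsetDl P A)).
  by rewrite card_notin cP card_ord; apply; lia.
rewrite sum_nat_const card_powerset cP /subset_bound -mul2n mulnA -expnS.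
by rewrite subn1 prednK.
Qed.

(** * The extremal sequence *)

Lemma card_subsets_le (T : finType) (m : nat) :
  #|[set B : {set T} | (#|B| <= m)%N]| = (\sum_(0 <= j < m.+1) 'C(#|T|, j))%N.
Proof.
rewrite (@card_layers _ _ m); last by move=> B; rewrite inE.
apply: eq_big_nat => j /andP[_ jm]; rewrite -card_draws; apply: eq_card => B.
by rewrite !inE; case: eqP => [->|]; rewrite ?andbF ?andbT.
Qed.

Definition ltords (n t : nat) : {set 'I_n} := [set i : 'I_n | (i < t)%N].

Lemma card_ltords (n t : nat) : (t <= n)%N -> #|ltords n t| = t.
Proof.
move=> tn.
have inj : injective (widen_ord tn).
  by move=> i j eq_ij; apply: val_inj; exact: (congr1 val eq_ij).
rewrite -[RHS]card_ord -[RHS]cardsT -(card_imset _ inj).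
apply: eq_card => i; rewrite inE; apply/idP/imsetP => [it | [j _ ->]].
  by exists (Ordinal it) => //; apply: val_inj.
exact: (ltn_ord j).
Qed.

(* The index o is meant to be 0. *)
Definition extremal (R : realType) (n k t : nat) (o i : 'I_n) : R :=
  ((i == o) * (k - t))%:R - (t <= i)%N%:R.

Lemma sum_extremal (R : realType) (n k t : nat) (o : 'I_n) (U : {set 'I_n}) :
  \sum_(i in U) extremal R k t o i = ((o \in U) * (k - t))%:R - #|U :\: ltords n t|%:R.
Proof.
rewrite sumrB -!natr_sum; congr (_%:R - _%:R).
  rewrite -big_distrl /=; congr muln; have [oU|oU] := boolP (o \in U).
    by rewrite (bigD1 o) //= eqxx big1 // => i /andP[_ /negPf ->].
  by apply: big1 => i iU; case: eqP oU => // <-; rewrite iU.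
rewrite -sum1_card [RHS](eq_bigl (fun i => (i \in U) && (t <= i)%N)) => [|i]; last first.
  by rewrite !inE -leqNgt andbC.
by rewrite big_mkcondr; apply: eq_bigr => i _; case: leqP.
Qed.

Lemma nonneg_extremal (R : realType) (n k t : nat) (o : 'I_n) :
  o = 0%N :> nat -> (0 < t)%N -> [set i | 0 <= extremal R k t o i] = ltords n t.
Proof.
move=> o0 t0; apply/setP=> i; rewrite !inE /extremal subr_ge0 ler_nat leqNgt.
have [it|ti] := ltnP i t; first by rewrite ltn0.
by have -> : (i == o) = false; [apply/negP=> /eqP io; move: ti; rewrite io o0; lia | ].
Qed.

(** At most [t] elements of [U] lie in [ltords n t], so more than [k - t] entries equal to -1
    outweigh the single positive contribution. *)
Lemma extremal_large_sums (R : realType) (n k t : nat) (o : 'I_n) :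
  (t <= k)%N -> (k < n)%N -> large_sums_neg k (extremal R k t o).
Proof.
move=> tk kn U kU; rewrite sum_extremal subr_lt0 ltr_nat.
have := subset_leq_card (subsetIr U (ltords n t)).
rewrite card_ltords; last exact: leq_trans tk (ltnW kn).
move: kU; rewrite -(cardsID (ltords n t)); case: (o \in U) => /=;
  move: #|U :&: _| #|U :\: _|; lia.
Qed.

(** Each element of [B] costs 1 against a budget of [k - t] if [o] is in [A], and of 0 otherwise. *)
Lemma card_slice_extremal (R : realType) (n k t : nat) (o : 'I_n)
    (P := ltords n t) (A : {set 'I_n}) :
  o = 0%N :> nat -> (0 < t)%N -> (t <= n)%N -> A \subset P ->
  #|slice (nonneg_subsets (extremal R k t o)) P A| =
    (if o \in A then \sum_(0 <= j < (k - t).+1) 'C(n - t, j) else 1)%N.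
Proof.
move=> o0 t0 tn sAP; have cardC : #|{: {i : 'I_n | i \notin P}}| = (n - t)%N.
  by rewrite card_notin card_ord card_ltords.
have oP : o \in P by rewrite inE o0.
have oE (B : {set {i : 'I_n | i \notin P}}) : (o \in A :|: val @: B) = (o \in A).
  by rewrite -[in RHS](union_valE B sAP).2 in_setI oP andbT.
have sliceE (B : {set {i : 'I_n | i \notin P}}) :
    (B \in slice (nonneg_subsets (extremal R k t o)) P A) =
    (#|B| <= (o \in A) * (k - t))%N.
  rewrite !inE sum_extremal subr_ge0 ler_nat (union_valE B sAP).1 oE.
  by rewrite card_imset //; exact: val_inj.
case: ifP => oA; last rewrite -(cards1 (@set0 {i : 'I_n | i \notin P})).
  rewrite -cardC -card_subsets_le; apply: eq_card => B.
  by rewrite sliceE oA mul1n inE.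
by apply: eq_card => B; rewrite sliceE oA mul0n leqn0 cards_eq0 inE.
Qed.

Lemma card_nonneg_subsets_extremal (R : realType) (n k t : nat) (o : 'I_n) :
  o = 0%N :> nat -> (0 < t)%N -> (t <= n)%N ->
  #|nonneg_subsets (extremal R k t o)| = subset_bound n k t.
Proof.
move=> o0 t0 tn; apply: double_inj; rewrite (double_card_slices _ (ltords n t)).
rewrite (eq_bigr (fun=> (\sum_(0 <= j < (k - t).+1) 'C(n - t, j)) + 1)%N); last first.
  move=> A; rewrite inE => sAP; rewrite !card_slice_extremal ?subsetDl //.
  rewrite !inE o0 t0 andbT.
  (* Exactly one of [A] and its complement in [ltords n t] contains [o]. *)
  by case: (o \in A); rewrite //= addnC.
rewrite sum_nat_const card_powerset card_ltords // /subset_bound -mul2n mulnA -expnS.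
by rewrite subn1 prednK.
Qed.

Theorem theorem1p2 (R : realType) (n k t : nat)
    (ht : (1 <= t)%N) (htk : (t <= k)%N) (hkn : (k < n)%N) :
  (forall x : 'I_n -> R,
     exactly_nonneg t x -> large_sums_neg k x ->
     (#|nonneg_subsets x| <= subset_bound n k t)%N)
  /\
  (exists x : 'I_n -> R,
     exactly_nonneg t x /\ large_sums_neg k x /\
     #|nonneg_subsets x| = subset_bound n k t).
Proof.
split=> [x xt xk|]; first exact: nonneg_subsets_le.
pose o : 'I_n := Ordinal (leq_ltn_trans (leq0n k) hkn).
exists (extremal R k t o); split; last split.
- by rewrite /exactly_nonneg nonneg_extremal // card_ltords // (leq_trans htk) // ltnW.
- exact: extremal_large_sums.
- by apply: card_nonneg_subsets_extremal => //; exact: leq_trans htk (ltnW hkn).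
Qed.
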